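(* The antipode of the Hopf monoid of posets $\mathbf P$ is given by the following cancellation-free and grouping-free expression. If $p$ is a poset on $I$ then $$\mathsf s_I(p)=\sum_q(-1)^{c(q)}\,q,$$ summing over all positive subposets $q$ of $p$, where $c(q)$ is the number of connected components of the Hasse diagram of $q$.
   Context: $\mathbf P[I]$ is the vector space, over a field of characteristic $0$, with basis the set of posets (partial orders $p\subseteq I\times I$) on the finite set $I$. For an ordered decomposition $I=S\sqcup T$, the product of posets $p_1$ on $S$ and $p_2$ on $T$ is the disjoint union $p_1\sqcup p_2$ (no relations between $S$ and $T$). The coproduct is $\Delta_{S,T}(p)=p|_S\otimes p|_T$ (induced posets) if $S$ is a lower set of $p$ (no element of $T$ is less than an element of $S$), and $\Delta_{S,T}(p)=0$ otherwise. These make $\mathbf P$ a connected Hopf monoid in vector species. With $\mu_{S_1,\dots,S_k},\Delta_{S_1,\dots,S_k}$ the iterated (co)products, the antipode is $\mathsf s_\emptyset=\mathrm{id}$ and, for $I\neq\emptyset$, $\mathsf s_I=\sum(-1)^k\mu_{S_1,\dots,S_k}\circ\Delta_{S_1,\dots,S_k}$, over all $k\ge1$ and ordered sequences of nonempty pairwise disjoint $S_1,\dots,S_k$ with union $I$. A circuit of $p$ is a cyclic sequence $i_1,\dots,i_n$ of elements of $I$ in which every two cyclically consecutive elements are (distinct and) comparable in $p$ (with $i_{n+1}=i_1$). Its up-edges are the consecutive pairs with $i_j<i_{j+1}$ in $p$, and its down-edges are those with $i_j>i_{j+1}$ in $p$. A subposet $q$ of $p$ is a poset on $I$ whose order relation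 is contained in that of $p$; an up- or down-edge of a circuit is in $q$ if the corresponding order relation holds in $q$. The subposet $q$ is positive if for every circuit $X$ of $p$: (1) if all the down-edges of $X$ are in $q$, then all the up-edges of $X$ are in $q$; and (2) if all the up-edges of $X$ are in $q$, then all the down-edges of $X$ are in $q$. The Hasse diagram of $q$ is the graph on $I$ whose edges are the cover relations of $q$. An expression $\sum_\alpha c_\alpha x_\alpha$ in basis elements is cancellation-free if no $\alpha\ne\beta$ have $x_\alpha=x_\beta$ with $c_\alpha,c_\beta$ of opposite sign, and grouping-free if the $x_\alpha$ are pairwise distinct. *)

(* Defs.v *)
From HB Require Import structures.
From mathcomp Require Import all_boot all_order all_algebra.
From mathcomp Require Import boolp.

Set Implicit Arguments.
Unset Strict Implicit.
Unset Printing Implicit Defensive.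

Import Order.TTheory GRing.Theory Num.Theory.
Local Open Scope ring_scope.

(* The free vector space on a finite type, with basis [bvec K x].  The tensor *)
(* product of the spaces on X and Y is identified with the space on X * Y.    *)
Notation linspan K X := {ffun X -> K^o}.

Section FreeSpaces.
Variable K : fieldType.

Definition bvec (X : finType) (x : X) : linspan K X := [ffun y => (y == x)%:R].

Definition linext (X : finType) (V : lmodType K) (f : X -> V)
  (v : linspan K X) : V := \sum_x v x *: f x.

Lemma linext_is_linear (X : finType) (V : lmodType K) (f : X -> V) :
  linear (@linext X V f).
Proof.
move=> a u v; rewrite /linext scaler_sumr -big_split /=.
by apply: eq_bigr => x _; rewrite !ffunE scalerDl scalerA.
Qed.

HB.instance Definition _ (X : finType) (V : lmodType K) (f : X -> V) :=
  GRing.isLinear.Build K (linspan K X) V _ (@linext X V f) (@linext_is_linear X V f).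

Lemma linext_bvec (X : finType) (V : lmodType K) (f : X -> V) x : linext f (bvec x) = f x.
Proof.
rewrite /linext (bigD1 x) //= ffunE eqxx scale1r big1 ?addr0 // => y yx.
by rewrite ffunE (negbTE yx) scale0r.
Qed.

Definition tens (X Y : finType) (v : linspan K X) (w : linspan K Y) :
  linspan K (X * Y)%type := [ffun z => v z.1 * w z.2].

Definition tensmap (X Y X' Y' : finType)
  (f : linspan K X -> linspan K X') (g : linspan K Y -> linspan K Y') :
  linspan K (X * Y)%type -> linspan K (X' * Y')%type :=
  linext (fun z => tens (f (bvec z.1)) (g (bvec z.2))).

End FreeSpaces.
Arguments bvec K {X} x.

(* Finite sets are the subsets I of an ambient finite type U; a partial order *)
(* on I is its set of pairs (x, y) with x <= y, a reflexive relation.         *)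
Section Posets.
Variable U : finType.
Implicit Types (I S T : {set U}) (r : {set U * U}).

Definition is_poset I r :=
  [&& r \subset setX I I,
      [forall x in I, (x, x) \in r],
      [forall x, forall y, ((x, y) \in r) && ((y, x) \in r) ==> (x == y)]
    & [forall x, forall y, forall z,
         ((x, y) \in r) && ((y, z) \in r) ==> ((x, z) \in r)]].

Record poset I := Poset { prel :> {set U * U}; prelP : is_poset I prel }.

HB.instance Definition _ I := [isSub for @prel I].
HB.instance Definition _ I := [Finite of poset I by <:].

Definition plt I (p : poset I) x y := (x != y) && ((x, y) \in prel p).

Lemma is_posetP I r :
  reflect [/\ r \subset setX I I, forall x, x \in I -> (x, x) \in r,
              forall x y, (x, y) \in r -> (y, x) \in r -> x = y
            & forall x y z, (x, y) \in r -> (y, z) \in r -> (x, z) \in r]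
          (is_poset I r).
Proof.
apply: (iffP and4P) => -[rI rr ra rt]; split=> //.
- by move=> x xI; apply: (implyP (forallP rr x)).
- move=> x y xy yx; apply/eqP/(implyP (forallP (forallP ra x) y)).
  by rewrite xy yx.
- move=> x y z xy yz; apply: (implyP (forallP (forallP (forallP rt x) y) z)).
  by rewrite xy yz.
- by apply/forallP => x; apply/implyP => /rr.
- apply/forallP => x; apply/forallP => y; apply/implyP => /andP[xy yx].
  by apply/eqP/ra.
- apply/forallP => x; apply/forallP => y; apply/forallP => z.
  by apply/implyP => /andP[]; apply: rt.
Qed.

Lemma discrete_is_poset I : is_poset I [set z | (z.1 \in I) && (z.1 == z.2)].
Proof.
apply/is_posetP; split=> [|x xI|x y|x y z]; rewrite ?inE ?xI ?eqxx //=.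
- apply/subsetP => -[x y]; rewrite !inE /= => /andP[xI /eqP <-].
  by rewrite xI.
- by case/andP=> _ /eqP.
- by case/andP=> xI /eqP <-; case/andP=> _ /eqP <-; rewrite xI eqxx.
Qed.
Definition discrete I := Poset (discrete_is_poset I).

Lemma restr_is_poset I S (sSI : S \subset I) (p : poset I) :
  is_poset S (prel p :&: setX S S).
Proof.
have /is_posetP[pI pr pa pt] := prelP p.
apply/is_posetP; split=> [|x xS|x y|x y z]; rewrite ?inE /=.
- exact: subsetIr.
- by rewrite xS pr // (subsetP sSI).
- by case/andP=> xy _ /andP[yx _]; apply: pa.
- by case/and3P=> xy -> _ /and3P[yz _ ->]; rewrite (pt _ _ _ xy yz).
Qed.
Definition restr I S (sSI : S \subset I) (p : poset I) : poset S :=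
  Poset (restr_is_poset sSI p).

(* The disjoint union; the default value is only reached when S and T are     *)
(* not disjoint (see [prel_dunion]).                                          *)
Definition dunion S T (p1 : poset S) (p2 : poset T) : poset (S :|: T) :=
  insubd (discrete (S :|: T)) (prel p1 :|: prel p2).

Lemma prel_dunion S T (p1 : poset S) (p2 : poset T) :
  [disjoint S & T] -> prel (dunion p1 p2) = prel p1 :|: prel p2.
Proof.
move=> dST; rewrite /dunion -[LHS]/(val _) insubdK //.
have /is_posetP[pI pr pa pt] := prelP p1.
have /is_posetP[qI qr qa qt] := prelP p2.
have pS x y : (x, y) \in prel p1 -> (x \in S) /\ (y \in S).
  by move/(subsetP pI); rewrite inE => /andP.
have qT x y : (x, y) \in prel p2 -> (x \in T) /\ (y \in T).
  by move/(subsetP qI); rewrite inE => /andP.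
have nST x : x \in S -> x \in T -> False.
  by move=> xS xT; move: (disjointFr dST xS); rewrite xT.
apply/is_posetP; split=> [|x|x y|x y z]; rewrite ?inE.
- apply/subsetP => -[x y]; rewrite !inE /=.
  by case/orP=> [/pS|/qT] [-> ->]; rewrite ?orbT.
- by case/orP=> [/pr|/qr] ->; rewrite ?orbT.
- case/orP=> xy /orP[] yx; [exact: pa | | | exact: qa].
    by case: (pS _ _ xy) (qT _ _ yx) => xS _ [_ /(nST _ xS)].
  by case: (pS _ _ yx) (qT _ _ xy) => yS _ [_ /(nST _ yS)].
- case/orP=> xy /orP[] yz.
  + by rewrite (pt _ _ _ xy yz).
  + by case: (pS _ _ xy) (qT _ _ yz) => _ yS [/(nST _ yS)].
  + by case: (pS _ _ yz) (qT _ _ xy) => yS _ [_ /(nST _ yS)].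
  + by rewrite (qt _ _ _ xy yz) orbT.
Qed.

Definition is_lower I S T (p : poset I) :=
  [forall t in T, forall s in S, ~~ plt p t s].

End Posets.

Section HopfMonoid.
Variables (K : fieldType) (U : finType).
Implicit Types (I S T : {set U}) (s : seq {set U}).

Definition mul S T :
  linspan K (poset S * poset T)%type -> linspan K (poset (S :|: T)) :=
  linext (fun z => bvec K (dunion z.1 z.2)).

Definition comul S T :
  linspan K (poset (S :|: T)) -> linspan K (poset S * poset T)%type :=
  linext (fun p => if is_lower S T p
                   then bvec K (restr (subsetUl S T) p, restr (subsetUr S T) p)
                   else 0).

(* A nonempty sequence of sets is given by its head S and its tail s.         *)
Fixpoint unions S s : {set U} :=
  if s is T :: s' then S :|: unions T s' else S.

Fixpoint posets S s : finType :=
  if s is T :: s' then (poset S * posets T s')%type : finType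
  else poset S : finType.

Fixpoint imul S s : linspan K (posets S s) -> linspan K (poset (unions S s)) :=
  match s with
  | [::] => id
  | T :: s' => fun v => @mul S (unions T s') (tensmap id (@imul T s') v)
  end.

Fixpoint icomul S s : linspan K (poset (unions S s)) -> linspan K (posets S s) :=
  match s with
  | [::] => id
  | T :: s' => fun v => tensmap id (@icomul T s') (@comul S (unions T s') v)
  end.

Definition is_composition I S s :=
  [&& all (fun T => T != set0) (S :: s),
      pairwise (fun A B : {set U} => [disjoint A & B]) (S :: s)
    & unions S s == I].

(* Sequences of k.+1 sets. *)
Definition composition I k :=
  {c : {set U} * k.-tuple {set U} | is_composition I c.1 c.2}.

Lemma composition_unions I k (c : composition I k) :
  unions (val c).1 (val c).2 = I.
Proof. by case/and3P: (valP c) => _ _ /eqP. Qed.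

Definition takeuchi_term I k (c : composition I k) :
  linspan K (poset I) -> linspan K (poset I) :=
  ecast J (linspan K (poset J) -> linspan K (poset J)) (composition_unions c)
    (fun v => imul (icomul v)).

(* The blocks being nonempty and disjoint, there are at most #|I| of them     *)
(* (see [composition_ltn]).                                                   *)
Definition antipode I (v : linspan K (poset I)) : linspan K (poset I) :=
  if I == set0 then v
  else \sum_(k < #|I|) \sum_(c : composition I k)
         (-1) ^+ k.+1 *: takeuchi_term c v.

Lemma composition_ltn I k (c : composition I k) : (k < #|I|)%N.
Proof.
case: c => -[S s] /= /and3P[+ + /eqP <-]; rewrite -[k in (k < _)%N](size_tuple s).
elim: (tval s) S => [|T r IHr] S; first by rewrite /= andbT card_gt0.
rewrite [pairwise _ _]/= [all _ _]/=.
move=> /andP[S0 r0] /andP[dS dr].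
have dSr : [disjoint S & unions T r].
  elim: r T dS {IHr r0 dr} => [|T' r IHr] T /= /andP[dT dS] //.
  by rewrite disjoints_subset setCU subsetI -!disjoints_subset dT IHr.
move: dSr; rewrite -setI_eq0 => /eqP dSr.
rewrite [size _]/= [unions _ _]/= cardsU dSr cards0 subn0.
rewrite -[leqLHS]add1n leq_add ?card_gt0 //.
by apply: IHr.
Qed.

End HopfMonoid.

Section PositiveSubposets.
Variables (U : finType) (I : {set U}).
Implicit Types (p q : poset I) (X : seq U).

Definition subposet q p := prel q \subset prel p.

Definition circuit p X :=
  (X != [::]) && cycle (fun x y => plt p x y || plt p y x) X.

Definition cpairs X : seq (U * U) := zip X (rot 1 X).
Definition up_edges p X := [seq e <- cpairs X | plt p e.1 e.2].
Definition down_edges p X := [seq e <- cpairs X | plt p e.2 e.1].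

Definition up_edges_in q p X := all (fun e => plt q e.1 e.2) (up_edges p X).
Definition down_edges_in q p X := all (fun e => plt q e.2 e.1) (down_edges p X).

Definition positive p q : Prop :=
  subposet q p /\
  forall X, circuit p X ->
    (down_edges_in q p X -> up_edges_in q p X) /\
    (up_edges_in q p X -> down_edges_in q p X).

Definition positive_subposets p : {set poset I} := [set q | `[< positive p q >]].

Definition covers q x y :=
  plt q x y && [forall z, ~~ (plt q x z && plt q z y)].
Definition hasse q : rel U := fun x y => covers q x y || covers q y x.

Definition ncomponents q : nat := n_comp (hasse q) I.

End PositiveSubposets.

(* The expression is \sum_(a in D) c a *: x a.  Its coefficients are integers  *)
(* because signs have no meaning in a general field of characteristic 0.      *)
Definition cancellation_free (A : finType) (V : Type) (D : {set A})
    (c : A -> int) (x : A -> V) :=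
  forall a b, a \in D -> b \in D -> a != b -> x a = x b -> ~ (c a * c b < 0).

Definition grouping_free (A : finType) (V : Type) (D : {set A})
    (x : A -> V) :=
  forall a b, a \in D -> b \in D -> a != b -> x a <> x b.

(* Main.v *)
Require Import Defs.
From HB Require Import structures.
From mathcomp Require Import all_boot all_order all_algebra.
From mathcomp Require Import boolp.

Set Implicit Arguments.
Unset Strict Implicit.
Unset Printing Implicit Defensive.

Import Order.TTheory GRing.Theory Num.Theory.
Local Open Scope ring_scope.

(** The coefficient of a subposet q in the antipode of p is an alternating
    count.  An ordered sequence of blocks contributes q exactly when each block
    is a lower set of p in what the earlier blocks leave, and is a union of
    connected components of q on which q agrees with p ([takeuchi_bvec]).  Contract the components of q and draw an arrow from one
    to another whenever p has a relation going that way: the sequences that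
    contribute are those in which q agrees with p on every component and the
    arrows go from strictly earlier to strictly later blocks.  So none exists
    unless the contracted digraph has no directed cycle, and this is what
    positivity says: a circuit of p whose down-edges all lie in q is a closed
    walk in the digraph, staying in place along every edge of q
    ([positiveP]).

    When the digraph is acyclic, the number of sequences counted with the sign
    of their length is (-1) to the number of components.  This goes by
    induction ([alternating_ways]): the possible first blocks are the unions of
    source components, removing them does not affect acyclicity, and the sum of
    the signs over all sets of sources, the empty one included, vanishes
    because a nonempty acyclic digraph has a source, whose membership can be
    toggled ([sum_blocks]).

    Each q occurs once in the resulting sum, so the expression is grouping-free
    and a fortiori cancellation-free. *)

(** * Counting connected components *)

Lemma n_compU (U : finType) (e : rel U) (A B : {set U}) :
  [disjoint A & B] -> n_comp e (A :|: B) = (n_comp e A + n_comp e B)%N.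
Proof.
move=> dAB; rewrite /n_comp_mem -(cardID (mem A) [predI roots e & A :|: B]).
congr (_ + _)%N; apply: eq_card => x; rewrite !inE.
  by case: (x \in A); rewrite ?andbT ?andbF.
have := disjointFr dAB (x := x).
by case: (x \in A) => [-> //|_]; rewrite ?andbT ?andbF.
Qed.

Lemma n_comp_set0 (U : finType) (e : rel U) : n_comp e (@set0 U) = 0%N.
Proof. by apply: eq_card0 => x; rewrite !inE andbF. Qed.

(** * Signed counts of block sequences *)

Section BlockCounts.
Variables (U : finType) (p q : {set U * U}).
Implicit Types (J S C : {set U}) (s : seq {set U}).

(** The connected components of [q] are the classes of the equivalence relation
    that this symmetric relation generates. *)
Definition linked : rel U := fun x y => ((x, y) \in q) || ((y, x) \in q).

(** The sets that can come first in a decomposition of [J] contributing [q]: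
    lower sets of [p] in [J] that are unions of components of [q], where [q]
    agrees with [p].  For [q] contained in [p] both conditions on [p] amount to
    the single implication below, since the components of [q] in [S] absorb
    everything that lies below them. *)
Definition block J S :=
  (S \subset J) &&
  [forall x in S, forall y in J,
     (((y, x) \in p) ==> ((y, x) \in q)) && (linked x y ==> (y \in S))].

Fixpoint admissible J S s :=
  block J S && (if s is T :: s' then admissible (J :\: S) T s' else true).

(** The walks of this relation are those of the contracted digraph: an arrow
    lifts to a relation of [p], and inside a component of [q] one can move up
    by [p] and down by [q]. *)
Definition step J : rel U := fun x y =>
  [&& x \in J, y \in J & ((x, y) \in p) || ((y, x) \in q)].

(** Acyclicity of the contracted digraph, together with the agreement of [p]
    and [q] on each component: a relation of [p] that closes up into a circuit
    must stay inside a component, where it must be a relation of [q]. *)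
Definition acyclic J :=
  [forall x in J, forall y in J,
     ((x, y) \in p) && connect (step J) y x ==> ((x, y) \in q)].

Lemma linked_sym : symmetric linked.
Proof. by move=> x y; rewrite /linked orbC. Qed.

Lemma connect_linked_sym : connect_sym linked.
Proof. exact/sym_connect_sym/linked_sym. Qed.

Lemma blockP J S :
  reflect [/\ S \subset J,
              forall x y, x \in S -> y \in J -> (y, x) \in p -> (y, x) \in q
            & forall x y, x \in S -> y \in J -> linked x y -> y \in S]
          (block J S).
Proof.
apply: (iffP andP) => [[SJ /forall_inP bS] | [SJ low clo]]; split=> //.
- move=> x y xS yJ yx; have /forall_inP/(_ y yJ)/andP[/implyP] := bS x xS.
  by move/(_ yx).
- move=> x y xS yJ xy; have /forall_inP/(_ y yJ)/andP[_ /implyP] := bS x xS.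
  by move/(_ xy).
apply/forall_inP => x xS; apply/forall_inP => y yJ.
apply/andP; split; apply/implyP; first exact: low.
exact: clo.
Qed.

Lemma acyclicP J :
  reflect (forall x y, x \in J -> y \in J -> (x, y) \in p ->
             connect (step J) y x -> (x, y) \in q)
          (acyclic J).
Proof.
apply: (iffP forall_inP) => [ac x y xJ yJ xy yx | ac x xJ].
  by have /forall_inP/(_ y yJ)/implyP := ac x xJ; rewrite xy yx; apply.
by apply/forall_inP => y yJ; apply/implyP => /andP[]; apply: ac.
Qed.

Hypothesis qp : q \subset p.

(** No walk enters a block from outside; this is why blocks are made of source
    components. *)
Lemma block_pred J S a b : block J S -> step J a b -> b \in S -> a \in S.
Proof.
case/blockP=> _ low clo /and3P[aJ bJ ab] bS.
apply: (clo b) => //; rewrite /linked.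
by case/orP: ab => [/(low _ _ bS aJ) | ] ->; rewrite ?orbT.
Qed.

Lemma block_connect J S a b :
  block J S -> connect (step J) a b -> a \notin S ->
  b \notin S /\ connect (step (J :\: S)) a b.
Proof.
move=> bS /connectP[w]; elim: w a => [|c w IHw] a /=.
  by move=> _ -> aS; split.
case/andP=> ac cw lw aS.
have cS : c \notin S by apply: contra aS; apply: block_pred ac.
have [bnS cb] := IHw c cw lw cS; split=> //.
apply: connect_trans cb; apply: connect1; case/and3P: ac => aJ cJ ac.
by rewrite /step !inE aS cS aJ cJ.
Qed.

(** Removing sources neither creates nor destroys directed cycles, as a cycle
    meets no source. *)
Lemma acyclic_block J S : block J S -> acyclic (J :\: S) = acyclic J.
Proof.
move=> bS; have /blockP[SJ low clo] := bS.
apply/acyclicP/acyclicP => ac x y; last first.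
  rewrite !inE => /andP[_ xJ] /andP[_ yJ] xy yx; apply: ac => //.
  apply: connect_sub yx => a b; rewrite /step !inE.
  case/and3P=> /andP[_ aJ] /andP[_ bJ] ab; apply: connect1.
  by rewrite /step aJ bJ.
move=> xJ yJ xy yx; have [yS | yS] := boolP (y \in S); first exact: low.
have [xS yx'] := block_connect bS yx yS.
by apply: ac; rewrite ?inE ?xS ?yS.
Qed.

Lemma connect_linked_step J x y :
  closed linked J -> x \in J -> connect linked x y -> connect (step J) x y.
Proof.
move=> cJ xJ /connectP[w]; elim: w x xJ => [|z w IHw] x xJ /=.
  by move=> _ ->; apply: connect0.
case/andP=> xz zw lw; have zJ : z \in J by rewrite -(cJ _ _ xz).
apply: connect_trans (IHw z zJ zw lw); apply: connect1.
rewrite /step xJ zJ; case/orP: xz => [/(subsetP qp) | ] -> //.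
by rewrite orbT.
Qed.

(** A source component is found at a vertex with the fewest predecessors: a
    predecessor [y] of its component has no more predecessors than it, hence is
    reachable from it, and acyclicity puts the relation from [y] into [q]. *)
Lemma acyclic_source J :
  closed linked J -> acyclic J -> J != set0 ->
  exists2 x, x \in J & block J [set z | connect linked x z].
Proof.
move=> cJ /acyclicP ac /set0Pn[x0 x0J].
pose before x := [set z | connect (step J) z x].
have [x xJ minx] : exists2 x, x \in J
    & forall y, y \in J -> (#|before x| <= #|before y|)%N.
  by case: (arg_minnP (fun x => #|before x|) x0J) => x xJ minx; exists x.
exists x => //.
have CJ z : connect linked x z -> z \in J.
  by move/(closed_connect cJ) <-.
apply/blockP; split.
- by apply/subsetP => z; rewrite inE; apply: CJ.
- move=> z y; rewrite inE => xz yJ yz; have zJ := CJ _ xz.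
  have zx : connect linked z x by rewrite connect_linked_sym.
  have yx : connect (step J) y x.
    apply: connect_trans (connect_linked_step cJ zJ zx).
    by apply: connect1; rewrite /step yJ zJ yz.
  apply: ac => //; apply: connect_trans (connect_linked_step cJ zJ zx) _.
  have sub : before y \subset before x.
    by apply/subsetP => t; rewrite !inE => ty; apply: connect_trans yx.
  have /eqP eqb : before y == before x by rewrite eqEcard sub minx.
  have : x \in before x by rewrite inE connect0.
  by rewrite -eqb inE.
- move=> z y; rewrite !inE => xz _ zy.
  exact: connect_trans xz (connect1 zy).
Qed.

Lemma block_closed J S : closed linked J -> block J S -> closed linked S.
Proof.
move=> cJ /blockP[SJ _ clo]; apply: (intro_closed connect_linked_sym).
move=> x y xy xS; apply: (clo x) => //.
by rewrite -(cJ _ _ xy) (subsetP SJ).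
Qed.

Lemma blockU J S C : block J S -> block J C -> block J (S :|: C).
Proof.
move=> /blockP[SJ lowS cloS] /blockP[CJ lowC cloC]; apply/blockP; split.
- by rewrite subUset SJ.
- by move=> x y; rewrite inE => /orP[]; [apply: lowS | apply: lowC].
- move=> x y; rewrite !inE => /orP[] xS yJ xy.
    by rewrite (cloS x y).
  by rewrite (cloC x y) ?orbT.
Qed.

Lemma blockD J S C : closed linked C -> block J S -> block J (S :\: C).
Proof.
move=> cC /blockP[SJ low clo]; apply/blockP; split.
- exact: subset_trans (subsetDl _ _) SJ.
- by move=> x y /setDP[xS _]; apply: low.
- move=> x y /setDP[xS xC] yJ xy; rewrite inE (clo x) // andbT.
  by rewrite -(cC _ _ xy).
Qed.

Lemma block0 J : block J set0.
Proof. by apply/blockP; split=> [|x y|x y]; rewrite ?sub0set // inE. Qed.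

Section Signs.
Variable R : nzRingType.

(** Blocks are paired by adding or removing the source component [C], which
    changes the number of components by one. *)
Lemma sum_blocks J :
  closed linked J -> acyclic J -> J != set0 ->
  \sum_(S | block J S) (-1) ^+ n_comp linked S = 0 :> R.
Proof.
move=> cJ acJ J0; have [x xJ] := acyclic_source cJ acJ J0.
set C := [set z | _] => bC; have cC := block_closed cJ bC.
have xC : x \in C by rewrite inE connect0.
have nC : n_comp linked C = 1%N.
  rewrite -(n_comp_connect connect_linked_sym x).
  by apply: eq_n_comp_r => z; rewrite inE.
(* Being a union of components, a block contains [C] once it contains [x]. *)
rewrite (bigID (fun S : {set U} => x \in S)) /=.
rewrite (reindex_onto (fun S => S :|: C) (fun S => S :\: C)) /=; last first.
  move=> S /andP[bS xS]; have cS := block_closed cJ bS.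
  rewrite setUC -[in RHS](setID S C); congr (_ :|: _).
  apply/esym/setIidPr/subsetP => z; rewrite inE.
  by move/(closed_connect cS) <-.
rewrite (eq_bigl (fun S => block J S && (x \notin S))) => [|S]; last first.
  rewrite inE xC orbT andbT; apply/andP/andP => [[bSC /eqP eS]|[bS xS]].
    by rewrite -eS blockD // inE xC.
  split; first exact: blockU.
  have cS := block_closed cJ bS; apply/eqP/setP => z; rewrite !inE.
  case: (boolP (connect linked x z)) => xz; last by rewrite orbF.
  by rewrite -(closed_connect cS xz) (negbTE xS).
rewrite -big_split big1 //= => S /andP[bS xS].
have cS := block_closed cJ bS.
rewrite n_compU ?nC; last first.
  rewrite disjoint_sym disjoints_subset; apply/subsetP => z; rewrite !inE.
  by move/(closed_connect cS) <-.
by rewrite addn1 exprS mulN1r addNr.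
Qed.

(** The number of sequences of [k] nonempty blocks exhausting [J], each a block
    of what the previous ones leave. *)
Fixpoint ways k J : R :=
  if k is k'.+1 then \sum_(S | (S != set0) && block J S) ways k' (J :\: S)
  else (J == set0)%:R.

Lemma ways_set0 k : ways k.+1 set0 = 0.
Proof.
rewrite /= big_pred0 // => S; apply/negP => /andP[S0 /blockP[+ _ _]].
by rewrite subset0 (negbTE S0).
Qed.

(** Splitting off the first block [S] and applying the induction hypothesis to
    the rest leaves, up to sign, the sum of signs over the nonempty [S], which
    is -1 by [sum_blocks].  If [J] is not acyclic, no remainder is, and all
    terms vanish. *)
Lemma alternating_ways n J :
  closed linked J -> (#|J| <= n)%N ->
  \sum_(k < n.+1) (-1) ^+ k * ways k J
    = (-1) ^+ n_comp linked J * (acyclic J)%:R.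
Proof.
elim: n J => [|n IHn] J cJ leJ; have [J0 | J0] := eqVneq J set0.
1,3: rewrite J0 big_ord_recl big1 => [|k _]; rewrite ?ways_set0 ?mulr0 //.
1,2: rewrite /= eqxx n_comp_set0 addr0 (_ : acyclic set0) //.
1,2: by apply/acyclicP => x y; rewrite inE.
  by rewrite -cards_eq0 -leqn0 leJ in J0.
rewrite big_ord_recl /= (negbTE J0) mulr0 add0r.
under eq_bigr => k _ do rewrite /bump /= add1n exprS mulN1r mulNr mulr_sumr.
rewrite sumrN exchange_big /=.
have eqS S : (S != set0) && block J S ->
    \sum_(k < n.+1) (-1) ^+ k * ways k (J :\: S)
      = (-1) ^+ n_comp linked J * (acyclic J)%:R * (-1) ^+ n_comp linked S.
  case/andP=> S0 bS; have cS := block_closed cJ bS.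
  have SJ : S \subset J by case/blockP: bS.
  rewrite IHn; first last.
  - rewrite -ltnS; apply: leq_trans leJ; apply: proper_card.
    rewrite properEneq subsetDl andbT; apply: contraNneq S0 => eJ.
    by rewrite -(setIidPl SJ) -eJ setIDA setDIl setDv set0I.
  - by move=> a b ab; rewrite !inE (cJ _ _ ab) (cS _ _ ab).
  have nJ : n_comp linked J = (n_comp linked (J :\: S) + n_comp linked S)%N.
    rewrite -n_compU; first by rewrite -{1}(setID J S) (setIidPr SJ) setUC.
    by rewrite -setI_eq0 setIDAC setDIl setDv setI0.
  rewrite acyclic_block // nJ exprD -!mulrA; congr (_ * _).
  by rewrite mulr_natl mulrnAr -expr2 sqrr_sign.
rewrite (eq_bigr _ eqS) -mulr_sumr.
have [ac|_] := boolP (acyclic J); last by rewrite mulr0 mul0r oppr0.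
have := sum_blocks cJ ac J0; rewrite (bigD1 set0) ?block0 //= n_comp_set0.
move/eqP; rewrite addrC addr_eq0 => /eqP sumS.
under eq_bigl => S do rewrite andbC.
by rewrite sumS mulrN opprK mulr1.
Qed.

End Signs.
End BlockCounts.

(** * Positivity as acyclicity *)

Section Positivity.
Variables (U : finType) (I : {set U}).
Implicit Types (p q : poset I) (X : seq U).

Lemma prel_sub p x y : (x, y) \in prel p -> x \in I /\ y \in I.
Proof.
by have /is_posetP[pI _ _ _] := prelP p; move/(subsetP pI); rewrite inE => /andP.
Qed.

Lemma prel_refl p x : x \in I -> (x, x) \in prel p.
Proof. by have /is_posetP[_ pr _ _] := prelP p; apply: pr. Qed.

Lemma prel_trans p x y z :
  (x, y) \in prel p -> (y, z) \in prel p -> (x, z) \in prel p.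
Proof. by have /is_posetP[_ _ _ pt] := prelP p; apply: pt. Qed.

Lemma plt_asym p x y : plt p x y -> plt p y x = false.
Proof.
case/andP=> nxy xy; apply/negP => /andP[_ yx]; have /is_posetP[_ _ pa _] := prelP p.
by rewrite (pa _ _ xy yx) eqxx in nxy.
Qed.

Lemma plt_trans p x y z : plt p x y -> plt p y z -> plt p x z.
Proof.
move=> xy yz; rewrite /plt (prel_trans (p := p) (y := y)) ?andbT.
- by apply/eqP => exz; rewrite exz (plt_asym yz) in xy.
- by case/andP: xy.
- by case/andP: yz.
Qed.

Lemma plt_sub p q x y : subposet q p -> plt q x y -> plt p x y.
Proof. by move=> qp /andP[nxy xy]; rewrite /plt nxy (subsetP qp). Qed.

Lemma all_cpairs (r : rel U) X : all (fun e => r e.1 e.2) (cpairs X) = cycle r X.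
Proof.
case: X => [|x s] //; rewrite /cpairs rot1_cons [cycle _ _]/=.
by elim: s x {2 4}x => [|y s IHs] x z //=; rewrite IHs.
Qed.

Lemma all_up p (r : rel U) X :
  all (fun e => r e.1 e.2) (up_edges p X) = cycle (fun x y => plt p x y ==> r x y) X.
Proof. by rewrite all_filter -all_cpairs. Qed.

Lemma all_down p (r : rel U) X :
  all (fun e => r e.2 e.1) (down_edges p X)
    = cycle (fun x y => plt p y x ==> r y x) X.
Proof. by rewrite all_filter -all_cpairs. Qed.

(** Following the rest of the cycle leads from the end of one of its edges back
    to the start. *)
Lemma cycle_connect (r : rel U) X x y :
  cycle r X -> (x, y) \in cpairs X -> connect r y x.
Proof.
move=> cX xyX; have xX : x \in X.
  by have := map_f fst xyX; rewrite -/(unzip1 _) unzip1_zip ?size_rot.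
have yX : y \in X.
  by have := map_f snd xyX; rewrite -/(unzip2 _) unzip2_zip ?size_rot // mem_rot.
exact: (connect_cycle cX).
Qed.

Lemma strict_step p q : subposet q p ->
  connect (step p q I) =2 connect (fun x y => plt p x y || plt q y x).
Proof.
move=> qp x y; apply/idP/idP; apply: connect_sub => a b; last first.
  by case/orP=> /andP[_ ab]; apply: connect1; have [aI bI] := prel_sub ab;
     rewrite /step aI bI ab ?orbT.
case/and3P=> _ _ ab; have [->|nab] := eqVneq a b; first exact: connect0.
by apply: connect1; rewrite /plt nab eq_sym nab.
Qed.

(** The first condition of positivity, on the circuits whose down-edges are in
    [q], is acyclicity read around the circuit.  The second condition is the
    first one for the reversed circuit, so it needs no separate notion. *)
Lemma positiveP p q : positive p q <-> subposet q p /\ acyclic p q I.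
Proof.
split=> [[qp pos] | [qp /acyclicP ac]]; split=> //.
  apply/acyclicP => x y xI yI xy; have [<-|nxy] := eqVneq x y.
    by rewrite prel_refl.
  rewrite (strict_step qp) => /connectP[w yw lw].
  have ltxy : plt p x y by rewrite /plt nxy.
  have cX (r : rel U) : path r y w -> r x y -> cycle r (y :: w).
    by move=> rw rxy; rewrite /= rcons_path rw -lw.
  have circ : circuit p (y :: w).
    apply: cX; last by rewrite ltxy.
    apply: sub_path yw => a b /orP[-> // | /(plt_sub qp) ->]; exact: orbT.
  have [] := pos _ circ.
  rewrite /down_edges_in /up_edges_in all_down all_up /= => + _.
  have /cX : path (fun a b => plt p b a ==> plt q b a) y w.
    apply: sub_path yw => a b /orP[/plt_asym -> // | ->]; exact: implybT.
  rewrite (plt_asym ltxy) => /(_ isT) /= -> /(_ isT).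
  by rewrite rcons_path -lw ltxy => /andP[_ /andP[]].
have acs x y : plt p x y -> connect (fun x y => plt p x y || plt q y x) y x ->
    plt q x y.
  case/andP=> nxy xy yx; have [xI yI] := prel_sub xy.
  by rewrite /plt nxy ac // (strict_step qp).
(* An edge of [X] outside [q] would be closed up by the rest of the circuit. *)
move=> X /andP[_ cX]; rewrite /up_edges_in /down_edges_in all_down all_up.
split=> cyc.
  rewrite -all_cpairs; apply/allP => -[x y] /= xyX; apply/implyP => xy.
  apply: acs xy _; apply: cycle_connect xyX.
  have := introT andP (conj cX cyc); rewrite -!all_cpairs -all_predI.
  apply: sub_all => -[a b] /= /andP[/orP[-> // | ba] /implyP -> //].
  exact: orbT.
(* Run backwards, the circuit has its downward steps in [q]. *)
rewrite -all_cpairs; apply/allP => -[x y] /= xyX; apply/implyP => yx.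
apply: acs yx _; rewrite connect_rev /=.
apply: cycle_connect xyX.
have := introT andP (conj cX cyc); rewrite -!all_cpairs -all_predI.
apply: sub_all => -[a b] /= /andP[/orP[ab | -> //] /implyP -> //].
exact: orbT.
Qed.

Lemma hasse_sym q : connect_sym (hasse q).
Proof. by apply: sym_connect_sym => x y; rewrite /hasse orbC. Qed.

(** A relation that is not a cover is split at an intermediate element, and the
    two open intervals obtained are smaller. *)
Lemma plt_hasse q x y : plt q x y -> connect (hasse q) x y.
Proof.
have [n] := ubnP #|[set z | plt q x z && plt q z y]|.
elim: n x y => // n IHn x y lt_n xy.
have [cxy | ] := boolP (covers q x y); first by apply: connect1; rewrite /hasse cxy.
rewrite /covers xy negb_forall => /existsP[z]; rewrite negbK => /andP[xz zy].
have smaller a b : (a, b) \in [:: (x, z); (z, y)] ->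
    (#|[set t | plt q a t && plt q t b]| < n)%N.
  move=> ab; rewrite -ltnS; apply: leq_trans lt_n; rewrite ltnS.
  apply: proper_card; apply/properP; split.
    apply/subsetP => t; rewrite !inE in ab *.
    case/orP: ab => /eqP[-> ->] /andP[at_ tb].
      by rewrite at_ (plt_trans tb).
    by rewrite tb (plt_trans xz).
  exists z; first by rewrite inE xz.
  by rewrite !inE in ab *; case/orP: ab => /eqP[-> ->]; rewrite /plt eqxx ?andbF.
by apply: (connect_trans (y := z)); apply: IHn => //; apply: smaller;
   rewrite !inE eqxx ?orbT.
Qed.

(** Cover relations and all relations of [q] connect the same elements, so the
    Hasse diagram counts the components used above. *)
Lemma ncomponents_linked q : ncomponents q = n_comp (linked q) I.
Proof.
apply: eq_n_comp => x y; apply/idP/idP; apply: connect_sub => a b.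
  by case/orP=> /andP[/andP[_ ab] _]; apply: connect1; rewrite /linked ab ?orbT.
have [-> | nab] := eqVneq a b; first by move=> _; apply: connect0.
case/orP=> ab; first by apply: plt_hasse; rewrite /plt nab.
by rewrite hasse_sym; apply: plt_hasse; rewrite /plt eq_sym nab.
Qed.

Lemma closed_linked q : closed (linked q) I.
Proof. by move=> x y /orP[] /prel_sub[-> ->]. Qed.

End Positivity.

(** * Block sequences in the antipode *)

Section Blocks.
Variable U : finType.
Implicit Types (J S T : {set U}) (s : seq {set U}).

(** Iterated coproduct and product send a basis element to a basis element or to
    zero; [pieces] and [glue] are these maps on bases and [lower_chain] is the
    condition for the coproduct not to vanish. *)
Fixpoint pieces S s : poset (unions S s) -> posets S s :=
  match s with
  | [::] => id
  | T :: s' => fun p => (restr (subsetUl S (unions T s')) p,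
                         pieces (restr (subsetUr S (unions T s')) p))
  end.

Fixpoint glue S s : posets S s -> poset (unions S s) :=
  match s with
  | [::] => id
  | T :: s' => fun z => dunion z.1 (glue z.2)
  end.

Fixpoint lower_chain S s : poset (unions S s) -> bool :=
  match s with
  | [::] => fun=> true
  | T :: s' => fun p => is_lower S (unions T s') p
                        && lower_chain (restr (subsetUr S (unions T s')) p)
  end.

Section Linear.
Variable K : fieldType.

Lemma tens_bvec (X Y : finType) (x : X) (y : Y) :
  tens (bvec K x) (bvec K y) = bvec K (x, y).
Proof.
apply/ffunP => -[a b]; rewrite !ffunE /= xpair_eqE.
by case: eqP; rewrite ?mul1r ?mul0r.
Qed.

Lemma tens0 (X Y : finType) (v : linspan K X) :
  tens v (0 : linspan K Y) = 0.
Proof. by apply/ffunP => z; rewrite !ffunE mulr0. Qed.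

Lemma icomul_bvec S s (p : poset (unions S s)) :
  icomul (bvec K p) = if lower_chain p then bvec K (pieces p) else 0.
Proof.
elim: s S p => [|T s IHs] S p //=; rewrite /comul linext_bvec.
case: ifP => _ /=; last by rewrite /tensmap raddf0.
rewrite /tensmap linext_bvec /= IHs.
by case: ifP => _; rewrite ?tens_bvec ?tens0.
Qed.

Lemma imul_bvec S s (z : posets S s) : imul (bvec K z) = bvec K (glue z).
Proof.
elim: s S z => [|T s IHs] S z //=; rewrite /tensmap linext_bvec IHs tens_bvec.
by rewrite /Defs.mul linext_bvec.
Qed.

Lemma imul0 S s : imul (0 : linspan K (posets S s)) = 0.
Proof. by case: s => [|T s] //=; rewrite /tensmap raddf0 /Defs.mul raddf0. Qed.

End Linear.

Lemma disjoint_unions S T s :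
  pairwise (fun A B : {set U} => [disjoint A & B]) [:: S, T & s] ->
  [disjoint S & unions T s].
Proof.
case/andP=> + _; elim: s T => [|T' s IHs] T /=; first by rewrite andbT.
case/andP=> dT dS; rewrite disjoints_subset setCU subsetI.
by rewrite -!disjoints_subset dT IHs.
Qed.

(** Lets the recursion on sequences pass from a poset to its restriction. *)
Lemma admissible_local (p q p' q' : {set U * U}) J S s :
  {in J &, forall x y, ((x, y) \in p) = ((x, y) \in p')} ->
  {in J &, forall x y, ((x, y) \in q) = ((x, y) \in q')} ->
  admissible p q J S s = admissible p' q' J S s.
Proof.
elim: s J S => [|T s IHs] J S pp' qq' /=; last first.
  rewrite (IHs (J :\: S)) => [|x y /setDP[xJ _] /setDP[yJ _] |
                               x y /setDP[xJ _] /setDP[yJ _]]; last 2 first.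
  - exact: pp'.
  - exact: qq'.
congr (_ && _).
all: rewrite ?andbT /block; have [/subsetP SJ|//] := boolP (S \subset J).
all: apply: eq_forallb_in => x /SJ xJ; apply: eq_forallb_in => y yJ.
all: by rewrite /linked pp' ?qq'.
Qed.

(** The matching of one step of the iterated coproduct and product with one
    block.  If [q] is the disjoint union of the restriction of [p] to the lower
    set [S] with some [g], then relations of [p] ending in [S] start in [S],
    so are in [q], and nothing links [S] with [R].  Conversely, a relation of
    [p] from [R] to [S] would be one of [q], linking [S] with [R]. *)
Lemma dunion_block S R (p q : poset (S :|: R)) (g : poset R) :
  [disjoint S & R] -> subposet q p ->
  is_lower S R p && (q == dunion (restr (subsetUl S R) p) g)
    = block p q (S :|: R) S && (restr (subsetUr S R) q == g).
Proof.
move=> dSR qp; set pS := restr _ p; set qR := restr _ q.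
have nSR x : x \in S -> x \in R -> False.
  by move=> xS xR; rewrite (disjointFr dSR xS) in xR.
have inS x y : (x, y) \in prel pS = [&& (x, y) \in prel p, x \in S & y \in S].
  by rewrite /= !inE.
have inR x y : (x, y) \in prel qR = [&& (x, y) \in prel q, x \in R & y \in R].
  by rewrite /= !inE.
apply/andP/andP => [[low /eqP qE] | [/blockP[_ low clo] /eqP qE]].
  have qxy x y : (x, y) \in prel q = ((x, y) \in prel pS) || ((x, y) \in prel g).
    by rewrite {1}qE prel_dunion // inE.
  split.
    apply/blockP; split; first exact: subsetUl.
      move=> x y xS; rewrite inE => /orP[yS | yR] yx.
        by rewrite qxy inS yx yS xS.
      have /forall_inP/(_ x xS) := forall_inP low y yR.
      rewrite /plt yx andbT negbK => /eqP eyx.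
      by case: (nSR x xS); rewrite -eyx.
    move=> x y xS _; rewrite /linked !qxy !inS.
    by case/orP=> /orP[/and3P[_ ? ?] //| /prel_sub[? ?]]; case: (nSR x xS).
  apply/eqP/val_inj/setP => -[x y]; rewrite inR qxy inS.
  apply/andP/idP => [[/orP[/and3P[_ xS _] /andP[xR _]|//]] | xy].
    by case: (nSR x xS).
  by have [-> ->] := prel_sub xy; rewrite xy orbT.
split.
  apply/forall_inP => t tR; apply/forall_inP => s sS; apply/negP => /andP[_ ts].
  have tJ : t \in S :|: R by rewrite inE tR orbT.
  have tS : t \in S by apply: (clo s) => //; rewrite /linked (low s t) ?orbT.
  exact: (nSR t).
apply/eqP/val_inj/setP => -[x y].
rewrite [RHS](_ : _ = ((x, y) \in prel pS) || ((x, y) \in prel g)); last first.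
  by rewrite [val _]prel_dunion // inE.
rewrite -qE inS inR; apply/idP/orP => [xy | [/and3P[xy xS yS] | /andP[] //]].
  have [xJ yJ] := prel_sub xy.
  have [xS | xS] := boolP (x \in S).
    by left; rewrite (subsetP qp) //= (clo x) // /linked xy.
  right; rewrite xy; move: xJ; rewrite inE (negbTE xS) /= => -> /=.
  move: (yJ); rewrite inE => /orP[yS|//].
  case/negP: xS; apply: (clo y) => //; first by case: (prel_sub xy).
  by rewrite /linked xy orbT.
by apply: low => //; rewrite inE xS.
Qed.

Lemma glue_pieces_sub S s (p : poset (unions S s)) :
  pairwise (fun A B : {set U} => [disjoint A & B]) (S :: s) ->
  subposet (glue (pieces p)) p.
Proof.
elim: s S p => [|T s IHs] S p dS; first exact: subxx.
have /IHs sub := proj2 (andP dS).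
rewrite /subposet prel_dunion ?disjoint_unions // subUset subsetIl /=.
by apply: (subset_trans (sub (restr _ p))); apply: subsetIl.
Qed.

Lemma lower_chain_glue S s (p q : poset (unions S s)) :
  pairwise (fun A B : {set U} => [disjoint A & B]) (S :: s) ->
  all (fun A : {set U} => A != set0) (S :: s) -> subposet q p ->
  lower_chain p && (q == glue (pieces p)) = admissible p q (unions S s) S s.
Proof.
elim: s S p q => [|T s IHs] S p q dS nz qp /=.
  rewrite andbT; apply/eqP/blockP => [<- | [_ low _]]; first by split.
  apply/val_inj/setP => -[x y]; apply/idP/idP => [/(subsetP qp) // | xy].
  by have [xS yS] := prel_sub xy; apply: low.
have dST := disjoint_unions dS; have /andP[_ ds] := dS; have /andP[_ nzs] := nz.
have qpR : subposet (restr (subsetUr S (unions T s)) q)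
                    (restr (subsetUr S (unions T s)) p) by exact: setSI.
rewrite -andbA andbCA dunion_block // andbCA IHs //.
have -> : (S :|: unions T s) :\: S = unions T s.
  by rewrite setDUl setDv set0U; apply/setDidPl; rewrite disjoint_sym.
congr (_ && _); apply: admissible_local => x y xR yR.
all: by rewrite /= !inE /= xR yR !andbT.
Qed.

Lemma is_composition_cons J S T s :
  is_composition J S (T :: s)
    = [&& S != set0, S \subset J & is_composition (J :\: S) T s].
Proof.
rewrite /is_composition ![all _ _]/= ![pairwise _ (S :: _)]/=.
apply/and3P/and3P => [[/andP[S0 nz] dS /eqP<-] | [S0 SJ /and3P[nz ds /eqP uE]]].
  split; rewrite ?subsetUl //; have dST := disjoint_unions dS.
  case/andP: dS => _ ds.
  apply/and3P; split=> //; rewrite setDUl setDv set0U eq_sym.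
  by apply/eqP/setDidPl; rewrite disjoint_sym.
split; first by rewrite S0.
  apply/andP; split; last exact: ds.
  have : [disjoint S & unions T s].
    by rewrite uE -setI_eq0 setIC setIDAC setDIl setDv setI0.
  elim: s T {nz ds uE} => [|T' s IHs] T /=; first by rewrite andbT.
  rewrite disjoints_subset setCU subsetI -!disjoints_subset.
  by case/andP=> -> /IHs.
by rewrite /= uE -{1}(setIidPr SJ) setID.
Qed.

Lemma is_composition1 J S : is_composition J S [::] = (S != set0) && (S == J).
Proof. by rewrite /is_composition /= !andbT. Qed.

Lemma sum_compositions (R : nzRingType) (p q : {set U * U}) k J :
  \sum_(c : composition J k) (admissible p q J (val c).1 (val c).2)%:R
    = ways p q R k.+1 J.
Proof.
transitivity (\sum_(c : {set U} * k.-tuple {set U} | is_composition J c.1 c.2)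
                (admissible p q J c.1 c.2)%:R : R).
  rewrite [RHS](reindex_omap (val : composition J k -> _) insub) => [|c cJ].
    by apply: eq_bigl => c; rewrite valK eqxx andbT (valP c).
  by rewrite insubT.
elim: k J => [|k IHk] J.
  rewrite (reindex (fun S : {set U} => (S, [tuple] : 0.-tuple {set U}))) /=.
    rewrite big_mkcond [RHS]big_mkcond; apply: eq_bigr => S _ /=.
    rewrite is_composition1 andbT; have [//|/= S0] := eqVneq S set0.
    have [<-|SJ] := eqVneq S J; first by rewrite setDv eqxx; case: block.
    case: ifP => // /blockP[sSJ _ _]; rewrite setD_eq0.
    by rewrite eqEsubset sSJ /= in SJ; rewrite (negbTE SJ).
  by exists fst => [S _|[S t] _] //=; rewrite [t]tuple0.
(* A sequence of k + 2 blocks is its head followed by one of k + 1 blocks. *)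
rewrite (reindex (fun c : {set U} * ({set U} * k.-tuple {set U}) =>
                    (c.1, [tuple of c.2.1 :: c.2.2]))) /=; last first.
  exists (fun c => (c.1, (thead c.2, [tuple of behead c.2]))).
    by move=> [S [T t]] _ /=; rewrite theadE; congr (_, (_, _)); apply: val_inj.
  by move=> [S t] _ /=; rewrite -tuple_eta.
under [RHS]eq_bigr => S _ do rewrite -[\sum_(_ | _) _]/(ways p q R k.+1 _) -IHk.
rewrite pair_big_dep [LHS]big_mkcond [RHS]big_mkcond; apply: eq_bigr => -[S [T t]] _ /=.
rewrite is_composition_cons /=; have [//|/= S0] := eqVneq S set0.
have [bS|nbS] := boolP (block p q J S); last by case: ifP.
by case/blockP: bS => ->.
Qed.

(** Admissibility puts the relations of [p] inside a block into [q]; that [q] has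
    no others is the separate condition that it is a subposet. *)
Lemma takeuchi_bvec (K : fieldType) J k (c : composition J k) (p q : poset J) :
  takeuchi_term c (bvec K p) q
    = (subposet q p && admissible p q J (val c).1 (val c).2)%:R.
Proof.
rewrite /takeuchi_term; case/and3P: (valP c) => nz ds _.
move: (composition_unions c) p q; move: (val c).1 (tval (val c).2) nz ds => S s nz ds {c}.
case: J / => p q /=; rewrite icomul_bvec.
have [qp|nqp] := boolP (subposet q p).
  rewrite -lower_chain_glue //=; case: ifP => _; last by rewrite imul0 ffunE.
  by rewrite imul_bvec ffunE.
case: ifP => _; last by rewrite imul0 ffunE.
rewrite imul_bvec ffunE; case: eqP => // eq_q.
by rewrite eq_q glue_pieces_sub in nqp.
Qed.

End Blocks.

(** * The antipode formula *)

Theorem corollary15p7 (K : fieldType) (charK0 : [pchar K] =i pred0)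
    (U : finType) (I : {set U}) (p : poset I) :
  [/\ antipode (bvec K p) =
        \sum_(q in positive_subposets p)
           ((-1) ^+ ncomponents q : int)%:~R *: bvec K q,
      cancellation_free (positive_subposets p)
        (fun q => (-1) ^+ ncomponents q) (fun q => bvec K q)
    & grouping_free (positive_subposets p) (fun q => bvec K q)].
Proof.
have bvec_inj : injective (fun q : poset I => bvec K q).
  move=> a b /ffunP/(_ a); rewrite !ffunE eqxx; case: eqP => // _ /eqP.
  by rewrite oner_eq0.
split; first last.
- by move=> a b _ _ nab /bvec_inj eab; rewrite eab eqxx in nab.
- by move=> a b _ _ nab /bvec_inj eab; rewrite eab eqxx in nab.
(* The coefficients predicted on the right are alternating counts of blocks. *)
have coefE (q : poset I) :
    (if q \in positive_subposets p then (-1) ^+ ncomponents q else 0 : K)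
      = \sum_(k < #|I|.+1) (-1) ^+ k
           * (if subposet q p then ways p q K k I else 0).
  rewrite inE; have [qp|nqp] := boolP (subposet q p).
    rewrite (alternating_ways qp _ (@closed_linked _ _ q)) // ncomponents_linked.
    rewrite (_ : `[< positive p q >] = acyclic p q I).
      by case: acyclic; rewrite ?mulr1 ?mulr0.
    by apply/asboolP/idP => [/positiveP[] | ac] //; apply/positiveP.
  rewrite big1 => [|k _]; last by rewrite mulr0.
  by case: asboolP => // /positiveP[qp]; rewrite qp in nqp.
apply/ffunP => q; rewrite sum_ffunE.
transitivity (if q \in positive_subposets p then (-1) ^+ ncomponents q else 0 : K).
  rewrite coefE /antipode; have [I0|I0] := eqVneq I set0.
    (* Without blocks to count, the antipode is the identity and the sum is 1. *)
    have noI z : z \in I = false by rewrite I0 inE.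
    have -> : p = q.
      by apply/val_inj/setP => -[x y]; apply/idP/idP => /prel_sub[]; rewrite noI.
    have cI : #|I| = 0%N by rewrite I0 cards0.
    by rewrite ffunE eqxx /subposet subxx cI big_ord1 mul1r /= (introT eqP I0).
  (* The empty sequence does not exhaust [I], so both sums run over the sequences
     of k + 1 blocks. *)
  rewrite big_ord_recl [X in _ = X + _](_ : _ = 0) ?add0r; last first.
    by rewrite /= (negbTE I0) if_same mulr0.
  rewrite sum_ffunE; apply: eq_bigr => k _.
  rewrite sum_ffunE lift0 -sum_compositions.
  under eq_bigr => c _ do rewrite ffunE takeuchi_bvec.
  rewrite -mulr_sumr; case: (subposet q p) => //.
  by rewrite /= big1.
have [qpos|nqpos] := boolP (q \in _); last first.
  rewrite big1 // => a apos; rewrite !ffunE; case: eqP => [eqa|_].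
    by rewrite eqa apos in nqpos.
  by rewrite scaler0.
rewrite (bigD1 q) //= big1 ?addr0 => [|a /andP[_ naq]].
  by rewrite !ffunE eqxx intr_sign [_ *: _]mulr1.
by rewrite !ffunE eq_sym (negbTE naq) scaler0.
Qed.
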